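(* Let $d\ge 2$ be an integer and let $\beta\in\mathbb{C}$ satisfy $\beta^d=1$, $\beta\neq 1$. Let $(k,m)\in\mathbb{N}\times\mathbb{N}^*$ and let $\mu$ be an eigenvalue of the map $G_{k,m}$ at a fixed point $z=(z_1,\dots,z_{k+m-1})$. Let $P_z$ be the polynomial associated to $z$, and suppose that $z_1$ is preperiodic of preperiod $k'$ and of period $m'$ to a cycle of multiplier $\lambda$ under $P_z$. Only one of the following cases happens: (1) $\mu=0$; (2) $\mu$ is an eigenvalue of the map $G_{k',m'}$ at a fixed point outside the post-critical set $PC(G_{k',m'})$; (3) $\mu^m=\lambda^{m/m'}$ and $\mu^{m'}\neq\lambda$.
   Context: $\mathbb{N}=\{0,1,2,\dots\}$ and $\mathbb{N}^*=\{1,2,\dots\}$. The maps $G_{k,m}\colon\mathbb{C}^{k+m-1}\to\mathbb{C}^{k+m-1}$ (depending also on the fixed $d$ and $\beta$) are defined, with the convention $x_0:=0$, as follows. If $k=0$: $G_{0,m}(x_1,\dots,x_{m-1})=(-x_{m-1}^d,\;x_1^d-x_{m-1}^d,\;\dots,\;x_{m-2}^d-x_{m-1}^d)$. If $k\neq 0$: the $i$-th coordinate of $G_{k,m}(x_1,\dots,x_{k+m-1})$ is $\left(x_{i-1}-\frac{\beta x_{k+m-1}-x_{k-1}}{\beta-1}\right)^d$ for $1\le i\le k+m-1$. An eigenvalue of $G_{k,m}$ at a fixed point $z$ is an eigenvalue of the differential $D_zG_{k,m}$. For a holomorphic self-map $f$ of $\mathbb{C}^n$, the critical set $C(f)$ is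 the set of points where the differential of $f$ is not invertible, and the post-critical set is $PC(f)=\bigcup_{j\ge 1}f^{\circ j}(C(f))$. The polynomial associated to $z\in\mathbb{C}^{k+m-1}$ (with the convention $z_0:=0$) is $P_z(t)=t^d-z_{m-1}^d$ if $k=0$, and $P_z(t)=\left(t-\frac{\beta z_{k+m-1}-z_{k-1}}{\beta-1}\right)^d$ if $k\neq 0$. If $z$ is a fixed point of $G_{k,m}$, then $z_i=P_z^{\circ i}(0)$ for all $1\le i\le k+m-1$, and $P_z$ is post-critically finite (its critical point has a finite forward orbit). A point $w$ is preperiodic of preperiod $k'\ge 0$ and of period $m'\ge 1$ under a polynomial $P$ if $P^{\circ(k'+m')}(w)=P^{\circ k'}(w)$ and $k',m'$ are the smallest integers with this property; the multiplier of the cycle on which it lands is $\lambda=(P^{\circ m'})'(P^{\circ k'}(w))$.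
   Formalization: The preperiod k', period m' and multiplier λ are those of z_0=0 instead of z_1 (false for z_1: d=2, β=-1, k=m=1, z=4, μ=2). ''Only one'' becomes: at least one case holds and (1) excludes (2) and (3); (2) and (3) can both hold (d=6, β=e^{iπ/3}, k=1, m=6, μ=6). *)

(* Defs.v *)
(* The definitions are over any numFieldType C; they are meant for C = R[i],
   the complex numbers, with R : realType. *)
From HB Require Import structures.
From mathcomp Require Import all_boot all_order all_algebra.
From mathcomp Require Import all_classical all_reals all_analysis.
From mathcomp Require Import complex.

Set Implicit Arguments.
Unset Strict Implicit.
Unset Printing Implicit Defensive.

Import Order.TTheory GRing.Theory Num.Theory.
Import numFieldNormedType.Exports.

Local Open Scope classical_set_scope.
Local Open Scope ring_scope.

(* The 1-based coordinate x_i of x = (x_1, ..., x_n), with x_0 := 0. Since row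
   vectors are indexed from 0, x_(j+1) is x ord0 j. The value 0 for i > n is
   never used below. *)
Definition crd (C : numFieldType) (n : nat) (x : 'rV[C]_n) (i : nat) : C :=
  if i is j.+1 then oapp (fun j' : 'I_n => x ord0 j') 0 (insub j) else 0.

Definition crit_pt (C : numFieldType) (beta : C) (k m : nat)
    (x : 'rV[C]_(k + m - 1)) : C :=
  (beta * crd x (k + m - 1) - crd x (k - 1)) / (beta - 1).

(* The entry of index i : 'I_(k + m - 1) is the (i + 1)-st coordinate, whence
   x_i for the "x_{i-1}" of the 1-based formulas. When k = 0, the first entry is
   x_0 ^+ d - x_(m-1) ^+ d = - x_(m-1) ^+ d, as d > 0. *)
Definition G (C : numFieldType) (d : nat) (beta : C) (k m : nat)
    (x : 'rV[C]_(k + m - 1)) : 'rV[C]_(k + m - 1) :=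
  \row_(i < k + m - 1)
    if k == 0%N then crd x i ^+ d - crd x (m - 1) ^+ d
    else (crd x i - crit_pt beta x) ^+ d.

Definition assoc_poly (C : numFieldType) (d : nat) (beta : C) (k m : nat)
    (z : 'rV[C]_(k + m - 1)) : {poly C} :=
  if k == 0%N then 'X^d - (crd z (m - 1) ^+ d)%:P
  else ('X - (crit_pt beta z)%:P) ^+ d.

Definition poly_iter (C : numFieldType) (P : {poly C}) (j : nat) : {poly C} :=
  iter j (fun Q => P \Po Q) 'X.

Definition preperiodic (C : numFieldType) (P : {poly C}) (w : C)
    (k m : nat) : Prop :=
  let returns k1 m1 :=
    (0 < m1)%N /\ (poly_iter P (k1 + m1)).[w] = (poly_iter P k1).[w] in
  returns k m /\
  (forall k1 m1, returns k1 m1 -> (k <= k1)%N /\ (m <= m1)%N).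

Definition multiplier (C : numFieldType) (P : {poly C}) (w : C)
    (k m : nat) : C :=
  (poly_iter P m)^`().[(poly_iter P k).[w]].

Definition critical_set (C : numFieldType) (n : nat)
    (f : 'rV[C]_n -> 'rV[C]_n) : set 'rV[C]_n :=
  [set x | 'J f x \notin unitmx].

Definition post_critical_set (C : numFieldType) (n : nat)
    (f : 'rV[C]_n -> 'rV[C]_n) : set 'rV[C]_n :=
  \bigcup_(j in [set j | (1 <= j)%N]) (iter j f @` critical_set f).

(* 'J f z is the matrix of the differential of f at z acting on row vectors, so
   its (left) eigenvectors are those of the differential. *)
Definition eigenvalue_at (C : numFieldType) (n : nat)
    (f : 'rV[C]_n -> 'rV[C]_n) (z : 'rV[C]_n) (mu : C) : Prop :=
  f z = z /\ eigenvalue ('J f z) mu.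

(* Main.v *)
Require Import Defs.
From HB Require Import structures.
From mathcomp Require Import all_boot all_order all_algebra.
From mathcomp Require Import all_classical all_reals all_analysis.
From mathcomp Require Import complex.
From mathcomp Require Import ring zify.

Set Implicit Arguments.
Unset Strict Implicit.
Unset Printing Implicit Defensive.

Import Order.TTheory GRing.Theory Num.Theory.
Import numFieldNormedType.Exports.

Local Open Scope classical_set_scope.
Local Open Scope ring_scope.

(** A fixed point of G_{k,m} records a critical orbit, and an eigenvector records
    a first-order variation along that orbit. After translating so that the
    critical point is 0, the orbit becomes w_0 = 0, w_{j+1} = w_j^d - c, and for
    mu != 0 an eigenvector becomes a multiple of the sequence e_0 = 0,
    e_{j+1} = d w_j^(d-1) e_j / mu + 1. All that remains of (k, m) is the pair of
    closing relations beta w_{k+m} = w_k and beta e_{k+m} = e_k, and this for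
    k = 0 as well as for k > 0. Thus mu != 0 is an eigenvalue of G_{k,m} at a
    fixed point exactly when some c satisfies both relations
    ([eigenvalue_resonant], [resonant_eigenvalue]), and the question becomes when
    they pass from (k, m) to the true preperiod and period (k', m').

    As beta^d = 1, the closing relations make w and e periodic of period m from
    index k + 1 on.

    If w_{k+m} = 0, then w returns to its starting point 0, so k' = 0. Every time
    w vanishes, e restarts at the value 1, hence e has period m' as well, and the
    relations hold for (0, m') ([resonant_periodic]).

    If w_{k+m} != 0, then k' = k and m' divides m, and w satisfies its closing
    relation for (k, m'). If e has period m' from index k + 1 on, it satisfies
    its own for (k, m'). Otherwise h_i = e_{i+m'} - e_i solves the homogeneous
    recursion h_{i+1} = d w_i^(d-1) h_i / mu, so going once around the orbit cycle
    multiplies h by lambda / mu^m'. As h has period m, mu^m = lambda^(m/m').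
    Moreover lambda = mu^m' is impossible: h would have period m', and e would
    grow by a fixed nonzero amount every m' steps, although it is periodic
    ([resonant_strict]).

    Finally, the fixed point produced for (k', m') has pairwise distinct
    coordinates 0, z_1, z_2, etc., by minimality of (k', m'), whereas every
    post-critical point has a coincidence among these
    ([post_critical_collision]). The case mu = 0 excludes the second one because
    a fixed point that is critical is its own image, hence post-critical; it
    excludes the third one because mu^m = lambda^(m/m') would give lambda = 0,
    that is, lambda = mu^m'. *)

(** * Preperiod and period of an orbit *)

Section FirstReturn.
Variables (T : Type) (u : nat -> T).
Hypothesis u_step : forall i j, u i = u j -> u i.+1 = u j.+1.

Definition first_return (k m : nat) :=
  [/\ (0 < m)%N, u (k + m) = u k &
   forall a b, (0 < b)%N -> u (a + b) = u a -> (k <= a)%N /\ (m <= b)%N].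

Lemma orbit_shift i j n : u i = u j -> u (i + n) = u (j + n).
Proof. by move=> uij; elim: n => [|n IH]; rewrite ?addn0 // !addnS; apply: u_step. Qed.

Lemma orbit_periodic k m i q : u (k + m) = u k -> (k <= i)%N ->
  u (i + q * m) = u i.
Proof.
move=> uk lei; elim: q => [|q IH]; first by rewrite addn0.
rewrite mulSn addnA -[RHS]IH -[in LHS](subnKC lei) -[in RHS](subnKC lei).
rewrite -!addnA; set j := (i - k + q * m)%N.
have -> : (k + (i - k + (m + q * m)) = k + m + j)%N by rewrite /j; lia.
exact: orbit_shift.
Qed.

(** Reducing a return time modulo the period yields a shorter return time, which
    minimality allows only if it is 0. *)
Lemma first_return_dvdn k m a b : first_return k m -> (0 < b)%N ->
  u (a + b) = u a -> (k <= a)%N /\ (m %| b)%N.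
Proof.
move=> [m0 uk minkm] b0 uab; have [lea _] := minkm _ _ b0 uab; split=> //.
rewrite /dvdn -leqn0 leqNgt; apply/negP => r0.
have uar : u (a + b %% m) = u a.
  rewrite -(orbit_periodic (b %/ m) uk (_ : k <= a + b %% m)%N) ?ltn_addr //; last lia.
  by rewrite -addnA [(b %% m + _)%N]addnC -divn_eq.
have [_] := minkm _ _ r0 uar; rewrite leqNgt ltn_pmod //.
Qed.

Lemma first_return_uniq k m a b : first_return k m -> (a < b)%N ->
  (b <= k + m - 1)%N -> u a <> u b.
Proof.
move=> km ltab leb uab; have [m0 _ _] := km.
have ba0 : (0 < b - a)%N by rewrite subn_gt0.
have [|lea dv] := first_return_dvdn km ba0 (a := a).
  by rewrite subnKC // ltnW.
have := dvdn_leq ba0 dv; lia.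
Qed.

End FirstReturn.

(** * Iterates of a polynomial and multipliers *)

Lemma poly_iterE (C : numFieldType) (P : {poly C}) j x :
  (poly_iter P j).[x] = iter j (fun t => P.[t]) x.
Proof. by elim: j => [|j IH] /=; rewrite ?hornerX // horner_comp IH. Qed.

Lemma deriv_poly_iter (C : numFieldType) (P : {poly C}) m x :
  (poly_iter P m)^`().[x] = \prod_(i < m) P^`().[(poly_iter P i).[x]].
Proof.
elim: m => [|m IH]; first by rewrite big_ord0 /= derivX hornerC.
by rewrite big_ord_recr /= deriv_comp hornerM horner_comp IH mulrC.
Qed.

Lemma multiplierE (C : numFieldType) (P : {poly C}) w k m :
  multiplier P w k m = \prod_(i < m) P^`().[(poly_iter P (k + i)).[w]].
Proof.
rewrite /multiplier deriv_poly_iter; apply: eq_bigr => i _; congr _.[_].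
by rewrite !poly_iterE addnC iterD.
Qed.

Lemma prod_periodic (C : comRingType) (p : nat -> C) m q :
  (forall i, p (i + m)%N = p i) ->
  \prod_(i < q * m) p i = (\prod_(i < m) p i) ^+ q.
Proof.
move=> pm; elim: q => [|q IH]; first by rewrite big_ord0.
rewrite mulSn big_split_ord exprS /= -IH; congr (_ * _).
by apply: eq_bigr => i _; rewrite addnC pm.
Qed.

(** * Coordinates of row vectors *)

Section Coordinates.
Variables (C : numFieldType) (n : nat).

(** The vector (f 1, ..., f n): the sequences below start with f 0 = 0, matching
    the convention x_0 = 0. *)
Definition row_of (f : nat -> C) : 'rV[C]_n := \row_(j < n) f j.+1.

Lemma crd_row_of (f : nat -> C) i : f 0%N = 0 -> (i <= n)%N ->
  crd (row_of f) i = f i.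
Proof.
case: i => [|i] // _ lt_i_n /=.
by rewrite insubT /= mxE.
Qed.

Lemma crdS (x : 'rV[C]_n) (i : 'I_n) : crd x i.+1 = x ord0 i.
Proof. by rewrite /crd valK. Qed.

Lemma crd_rowS (f : 'I_n -> C) (i : 'I_n) : crd (\row_j f j) i.+1 = f i.
Proof. by rewrite crdS mxE. Qed.

Lemma crdZ a (x : 'rV[C]_n) i : crd (a *: x) i = a * crd x i.
Proof.
case: i => [|i] /=; first by rewrite mulr0.
by case: insubP => [j _ _|_] /=; rewrite ?mxE ?mulr0.
Qed.

Lemma crd_ext (x y : 'rV[C]_n) :
  (forall i, (i < n)%N -> crd x i.+1 = crd y i.+1) -> x = y.
Proof. by move=> xy; apply/rowP => i; rewrite -!crdS xy. Qed.

Lemma crd_eq0 (x : 'rV[C]_n) : (forall i, (i < n)%N -> crd x i.+1 = 0) -> x = 0.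
Proof. by move=> x0; apply/rowP => i; rewrite mxE -crdS x0. Qed.

End Coordinates.

(** * The differential of G *)

Lemma is_diff_crd (C : numFieldType) n (x : 'rV[C]_n) i :
  is_diff x (fun y => crd y i) (fun v => crd v i).
Proof.
case: i => [|i] /=; first exact: (is_diff_cst (0 : C)).
case: insubP => [j _ _|_] /=; last exact: (is_diff_cst (0 : C)).
have lin : linear (fun v : 'rV[C]_n => v ord0 j) by move=> a u v; rewrite !mxE.
pose linM := GRing.isLinear.Build _ _ _ _ _ lin.
pose f : {linear 'rV[C]_n -> C} :=
  HB.pack (fun v : 'rV[C]_n => v ord0 j) linM.
apply: DiffDef; first exact: differentiable_coord.
exact: (@diff_lin _ _ _ f x (@coord_continuous _ _ _ ord0 j)).
Qed.

(** Stated for row vectors built entry by entry, so that the differential of G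
    can be computed one coordinate at a time. *)
Lemma is_diff_row (C : numFieldType) n p (g dg : 'I_p -> 'rV[C]_n -> C) x :
  (forall i, is_diff x (g i) (dg i)) ->
  is_diff x (fun y => \row_i g i y) (fun v => \row_i dg i v).
Proof.
move=> dgP.
have rowE (h : 'I_p -> 'rV[C]_n -> C) : (fun y => \row_i h i y) =
    \sum_i (fun y => h i y *: (delta_mx ord0 i : 'rV[C]_p)).
  apply/funext => y; rewrite fct_sumE [LHS]row_sum_delta.
  by apply: eq_bigr => i _; rewrite mxE.
rewrite !rowE.
apply: (big_ind2 (fun f df => is_diff x f df)) => [|f df h dh fP hP|i _].
- exact: (is_diff_cst (0 : 'rV[C]_p)).
- exact: is_diffD.
have := dgP i => diP; apply: DiffDef.
  exact: differentiableZl.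
by rewrite diffZl //; apply/funext => v; rewrite diff_val.
Qed.

Lemma is_diff_pow (C : numFieldType) n (f df : 'rV[C]_n -> C) (d : nat) x :
  is_diff x f df ->
  is_diff x (fun y => f y ^+ d) (fun v => d%:R * f x ^+ d.-1 * df v).
Proof.
case: d => [|d] fP.
  rewrite [X in is_diff _ _ X](_ : _ = 0); last first.
    by apply/funext => v; rewrite !mul0r.
  exact: (is_diff_cst (1 : C)).
rewrite (_ : (fun y => _) = f ^+ d.+1); last first.
  by apply/funext => y; rewrite exprfctE.
exact: is_diffX.
Qed.

(** The differential of G at z applied to v. As the critical point depends
    linearly on z, its variation is [crit_pt beta v]. *)
Definition dG (C : numFieldType) (d : nat) (beta : C) (k m : nat)
    (z v : 'rV[C]_(k + m - 1)) : 'rV[C]_(k + m - 1) :=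
  \row_(i < k + m - 1)
    if k == 0%N then
      d%:R * crd z i ^+ d.-1 * crd v i
      - d%:R * crd z (m - 1) ^+ d.-1 * crd v (m - 1)
    else d%:R * (crd z i - crit_pt beta z) ^+ d.-1
           * (crd v i - crit_pt beta v).

Lemma is_diff_G (C : numFieldType) (d : nat) (beta : C) (k m : nat)
    (z : 'rV[C]_(k + m - 1)) :
  is_diff z (@G C d beta k m) (dG d beta z).
Proof.
apply: (@is_diff_row C _ _ (fun i x => if k == 0%N then
  crd x i ^+ d - crd x (m - 1) ^+ d else (crd x i - crit_pt beta x) ^+ d)) => i.
have crdP := is_diff_crd z.
case: eqVneq => [k0|kn0].
  by apply: is_diffB; apply: is_diff_pow.
apply: (@is_diff_pow _ _ (fun x => crd x i - crit_pt beta x)).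
apply: is_diffB => //.
rewrite (_ : @crit_pt C beta k m = (beta - 1)^-1 *:
  (beta *: (fun y : 'rV[C]_(k + m - 1) => crd y (k + m - 1))
   - (fun y => crd y (k - 1)))).
  by apply: is_diffZ; apply: is_diffB; apply: is_diffZ.
by apply/funext => y; rewrite /crit_pt mulrC.
Qed.

Lemma mul_jacobian_G (C : numFieldType) (d : nat) (beta : C) (k m : nat)
    (z v : 'rV[C]_(k + m - 1)) :
  v *m 'J (@G C d beta k m) z = dG d beta z v.
Proof.
have := is_diff_G d beta z => GP.
by rewrite /jacobian mul_rV_lin1 diff_val.
Qed.

Lemma eigenvalue_G (C : numFieldType) (d : nat) (beta : C) (k m : nat)
    (z : 'rV[C]_(k + m - 1)) mu :
  eigenvalue ('J (@G C d beta k m) z) mu <->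
  exists2 v, dG d beta z v = mu *: v & v != 0.
Proof.
split=> [/eigenvalueP[v]|[v]]; rewrite ?mul_jacobian_G => vE vn0; first by exists v.
by apply/eigenvalueP; exists v; rewrite ?mul_jacobian_G.
Qed.

Lemma eigenvalue0 (F : fieldType) n (A : 'M[F]_n) :
  eigenvalue A 0 = (A \notin unitmx).
Proof.
by rewrite /eigenvalue /eigenspace raddf0 subr0 kermx_eq0 row_free_unit.
Qed.

(** * Normalized critical orbit and its variation *)

Section Spectrum.
Variables (C : numFieldType) (d : nat) (beta : C).
Hypotheses (hd : (2 <= d)%N) (hbeta : beta ^+ d = 1) (hbeta1 : beta != 1).

Let d_gt0 : (0 < d)%N. Proof. by apply: leq_trans hd. Qed.
Let d1_gt0 : (0 < d.-1)%N. Proof. by case: d hd => [|[]]. Qed.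
Let dn0 : d%:R != 0 :> C. Proof. by rewrite pnatr_eq0 -lt0n. Qed.
Let beta_neq0 : beta != 0.
Proof. by have := oner_neq0 C; rewrite -hbeta expf_eq0 d_gt0. Qed.
Let beta1n0 : beta - 1 != 0. Proof. by rewrite subr_eq0. Qed.

(** The orbit of the critical point 0 of t^d - c. For k > 0 the associated
    polynomial is (t - c)^d, its conjugate by the translation by c. *)
Definition crit_orbit (c : C) (j : nat) : C := iter j (fun t => t ^+ d - c) 0.

(** The eigenvector equation along the critical orbit, divided by mu. Its
    inhomogeneous term is the same for all coordinates and cannot vanish for a
    nonzero solution, which starts at 0; scaling the eigenvector makes it 1. *)
Fixpoint tangent (c mu : C) (j : nat) : C :=
  if j is i.+1 then d%:R * crit_orbit c i ^+ d.-1 * tangent c mu i / mu + 1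
  else 0.

(** The closing relations: the first says that c comes from a fixed point of
    G_{k,m}, the second that mu is an eigenvalue there. For k = 0 they reduce to
    both sequences vanishing at m. *)
Definition resonant (k m : nat) (c mu : C) :=
  beta * crit_orbit c (k + m) = crit_orbit c k /\
  beta * tangent c mu (k + m) = tangent c mu k.

(** Back to the coordinates of the fixed point. For k = 0 these start at the
    critical point; for k > 0 they start at the critical value w_1 = - c, moved
    to 0 by the translation by c. *)
Definition marked_orbit (k : nat) (c : C) (j : nat) : C :=
  if k == 0%N then crit_orbit c j else crit_orbit c j.+1 + c.

(** For k > 0 the critical point moves too: its variation is - 1 when the
    inhomogeneous term is normalized to 1. *)
Definition marked_tangent (k : nat) (c mu : C) (j : nat) : C :=
  if k == 0%N then tangent c mu j else tangent c mu j.+1 - 1.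

Lemma marked_orbit0 k c : marked_orbit k c 0 = 0.
Proof.
by rewrite /marked_orbit /=; case: ifP => // _; rewrite expr0n gtn_eqF // sub0r addNr.
Qed.

Lemma tangentS c mu i : tangent c mu i.+1 =
  d%:R * crit_orbit c i ^+ d.-1 * tangent c mu i / mu + 1.
Proof. by []. Qed.

Lemma tangent1 c mu : tangent c mu 1 = 1.
Proof. by rewrite /= mulr0 mul0r add0r. Qed.

Lemma marked_tangent0 k c mu : marked_tangent k c mu 0 = 0.
Proof. by rewrite /marked_tangent tangent1; case: ifP => // _; rewrite subrr. Qed.

(** * Eigenvalues in terms of the closing relations *)

Lemma crd_G0 m (x : 'rV[C]_(0 + m - 1)) i : (i < m - 1)%N ->
  crd (G d beta x) i.+1 = crd x i ^+ d - crd x (m - 1) ^+ d.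
Proof. by move=> lti; have := crd_rowS _ (Ordinal lti : 'I_(0 + m - 1)) => ->. Qed.

Lemma crd_GS k m (x : 'rV[C]_(k + m - 1)) i : (0 < k)%N -> (i < k + m - 1)%N ->
  crd (G d beta x) i.+1 = (crd x i - crit_pt beta x) ^+ d.
Proof.
move=> k0 lti; have := crd_rowS _ (Ordinal lti : 'I_(k + m - 1)) => -> /=.
by rewrite gtn_eqF.
Qed.

Lemma crd_dG0 m (x v : 'rV[C]_(0 + m - 1)) i : (i < m - 1)%N ->
  crd (dG d beta x v) i.+1 = d%:R * crd x i ^+ d.-1 * crd v i
      - d%:R * crd x (m - 1) ^+ d.-1 * crd v (m - 1).
Proof. by move=> lti; have := crd_rowS _ (Ordinal lti : 'I_(0 + m - 1)) => ->. Qed.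

Lemma crd_dGS k m (x v : 'rV[C]_(k + m - 1)) i : (0 < k)%N -> (i < k + m - 1)%N ->
  crd (dG d beta x v) i.+1 =
  d%:R * (crd x i - crit_pt beta x) ^+ d.-1 * (crd v i - crit_pt beta v).
Proof.
move=> k0 lti; have := crd_rowS _ (Ordinal lti : 'I_(k + m - 1)) => -> /=.
by rewrite gtn_eqF.
Qed.

(** The symmetric form of the definition of the critical point c: the two
    coordinates x_{k+m-1} and x_{k-1} differ by the rotation by beta around c,
    hence have the same image under (t - c)^d. *)
Lemma crit_ptP k m (x : 'rV[C]_(k + m - 1)) :
  beta * (crd x (k + m - 1) - crit_pt beta x) = crd x (k - 1) - crit_pt beta x.
Proof. by rewrite /crit_pt; field. Qed.

Lemma crit_pt_unique k m (x : 'rV[C]_(k + m - 1)) c :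
  beta * (crd x (k + m - 1) - c) = crd x (k - 1) - c -> crit_pt beta x = c.
Proof.
move=> cP; apply: (mulfI beta1n0); rewrite /crit_pt mulrC divfK //.
have -> : beta * crd x (k + m - 1) = crd x (k - 1) - c + beta * c.
  by rewrite -cP; ring.
by ring.
Qed.

(** The fixed point equation and the eigenvector equation are the two recursions,
    read coordinate by coordinate; the value c = z_{m-1}^d (k = 0) or the
    definition of the critical point c (k > 0) closes them. An eigenvector is a
    nonzero multiple of the normalized variation because the recursion has no
    nonzero solution without its inhomogeneous term. *)
Lemma eigenvalue_resonant k m (z : 'rV[C]_(k + m - 1)) mu :
  (0 < m)%N -> mu != 0 -> eigenvalue_at (@G C d beta k m) z mu ->
  exists2 c, resonant k m c mu &
    forall i, (i <= k + m - 1)%N -> crd z i = marked_orbit k c i.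
Proof.
move=> m0 mun0 [Gz /eigenvalue_G[v dGv vn0]].
have [k0|k0] := posnP k.
  subst k.
  pose c := crd z (m - 1) ^+ d.
  (* The inhomogeneous term of the recursion for v. *)
  pose a := - (d%:R * crd z (m - 1) ^+ d.-1 * crd v (m - 1)) / mu.
  have zE i : (i <= m - 1)%N -> crd z i = crit_orbit c i.
    elim: i => [//|i IH] lti.
    by rewrite -Gz crd_G0 // IH // ltnW.
  have vE i : (i <= m - 1)%N -> crd v i = a * tangent c mu i.
    elim: i => [_|i IH lti]; first by rewrite /= mulr0.
    have := crd_dG0 z v lti; rewrite dGv crdZ zE ?(ltnW lti) // IH ?(ltnW lti) //.
    move=> E; apply: (mulfI mun0); rewrite E /= /a; field.
    exact: mun0.
  have an0 : a != 0.
    apply: contraNneq vn0 => a0; apply/eqP/crd_eq0 => i lti.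
    by rewrite vE // a0 mul0r.
  have mE : m = (m - 1).+1 by rewrite subn1 prednK.
  exists c; last by move=> i; exact: zE.
  split; rewrite add0n mE /=.
    by rewrite -zE // /c subrr mulr0.
  apply: (mulfI an0); rewrite mulr0.
  suff -> : d%:R * crit_orbit c (m - 1) ^+ d.-1 * tangent c mu (m - 1) / mu + 1 = 0.
    by rewrite !mulr0.
  apply: (mulfI an0); rewrite mulr0.
  transitivity (d%:R * crit_orbit c (m - 1) ^+ d.-1
      * (a * tangent c mu (m - 1)) / mu + a); first by field.
  by rewrite -vE // -zE // /a mulNr subrr.
have n0 : (0 < k + m - 1)%N by lia.
pose c := crit_pt beta z; pose g := crit_pt beta v.
have zE i : (i <= k + m - 1)%N -> crd z i = crit_orbit c i.+1 + c.
  elim: i => [_|i IH lti].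
    by rewrite -[RHS]/(marked_orbit 1 c 0) marked_orbit0.
  by rewrite -{1}Gz crd_GS // IH ?(ltnW lti) // -/c addrK [RHS]subrK.
have vE i : (i <= k + m - 1)%N -> crd v i = - g * (tangent c mu i.+1 - 1).
  elim: i => [_|i IH lti]; first by rewrite tangent1 subrr mulr0.
  have := crd_dGS z v k0 lti; rewrite dGv crdZ zE ?(ltnW lti) // IH ?(ltnW lti) //.
  move=> E; apply: (mulfI mun0); rewrite E -/c -/g addrK (tangentS _ _ i.+1).
  by field.
have gn0 : g != 0.
  apply: contraNneq vn0 => g0; apply/eqP/crd_eq0 => i lti.
  by rewrite vE // g0 oppr0 mul0r.
exists c; last by move=> i /zE ->; rewrite /marked_orbit gtn_eqF.
have kmE : (k + m - 1).+1 = (k + m)%N by lia.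
have kE : (k - 1).+1 = k by lia.
split.
  have := crit_ptP z; rewrite -/c !zE ?kmE ?kE ?addrK //; lia.
have := crit_ptP v; rewrite -/g !vE ?kmE ?kE //; last by lia.
move=> E; apply: (mulfI (_ : - g != 0)); first by rewrite oppr_eq0.
move: E; set t := tangent _ _ _; set s := tangent _ _ _ => E.
transitivity (beta * (- g * (t - 1) - g)); first by ring.
by rewrite E; ring.
Qed.

Lemma resonant_crit_value m c : (0 < m)%N ->
  beta * crit_orbit c (0 + m) = crit_orbit c 0 -> crit_orbit c (m - 1) ^+ d = c.
Proof.
move=> m0 rw; apply/eqP; rewrite -subr_eq0; apply/eqP/(mulfI beta_neq0).
by rewrite mulr0 -[RHS]rw add0n -[in RHS](prednK m0) subn1.
Qed.

Lemma resonant_crit_pt k m (z : 'rV[C]_(k + m - 1)) c : (0 < k)%N -> (0 < m)%N ->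
  beta * crit_orbit c (k + m) = crit_orbit c k ->
  (forall i, (i <= k + m - 1)%N -> crd z i = marked_orbit k c i) ->
  crit_pt beta z = c.
Proof.
move=> k0 m0 rw zE; rewrite /marked_orbit gtn_eqF // in zE.
have kmE : (k + m - 1).+1 = (k + m)%N by lia.
have kE : (k - 1).+1 = k by lia.
by apply: crit_pt_unique; rewrite !zE ?kmE ?kE ?addrK //; lia.
Qed.

(** The converse construction, which is applied with (k', m') in place of
    (k, m). *)
Lemma resonant_eigenvalue k m c mu :
  (0 < m)%N -> mu != 0 -> resonant k m c mu ->
  eigenvalue_at (@G C d beta k m) (row_of _ (marked_orbit k c)) mu.
Proof.
move=> m0 mun0 [rw rt].
set z := row_of _ _; pose v := row_of (k + m - 1) (marked_tangent k c mu).
have zE i : (i <= k + m - 1)%N -> crd z i = marked_orbit k c i.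
  by move=> lei; rewrite crd_row_of // marked_orbit0.
have vE i : (i <= k + m - 1)%N -> crd v i = marked_tangent k c mu i.
  by move=> lei; rewrite crd_row_of // marked_tangent0.
suff [Gz dGv vn0] : [/\ G d beta z = z, dG d beta z v = mu *: v & v != 0].
  by split=> //; apply/eigenvalue_G; exists v.
have [k0|k0] := posnP k.
  subst k; rewrite /marked_orbit /marked_tangent /= in zE vE.
  have mE : m = (m - 1).+1 by rewrite subn1 prednK.
  have w0 : crit_orbit c (m - 1) ^+ d = c by apply: resonant_crit_value.
  have t0 : d%:R * crit_orbit c (m - 1) ^+ d.-1 * tangent c mu (m - 1) = - mu.
    have : beta * tangent c mu (m - 1).+1 = beta * 0 by rewrite -mE mulr0.
    move=> /(mulfI beta_neq0) /= E; rewrite -[LHS](divfK mun0).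
    by rewrite -[X in X * _](addrK 1) E; ring.
  split.
  - apply: crd_ext => i lti; rewrite crd_G0 // !zE ?(ltnW lti) //.
    by rewrite w0.
  - apply: crd_ext => i lti; rewrite crd_dG0 // crdZ !zE ?vE ?(ltnW lti) //.
    by rewrite t0 /=; field.
  have m1 : (0 < m - 1)%N.
    rewrite lt0n; apply: contraNneq mun0 => m10.
    by rewrite -oppr_eq0 -t0 m10 /= mulr0.
  apply/eqP => v0; have := vE 1%N m1; rewrite v0 -{1}(scale0r v) crdZ mul0r.
  by rewrite tangent1 => /eqP; rewrite eq_sym oner_eq0.
have cE : crit_pt beta z = c by apply: resonant_crit_pt.
rewrite /marked_orbit /marked_tangent gtn_eqF // in zE vE.
have kmE : (k + m - 1).+1 = (k + m)%N by lia.
have kE : (k - 1).+1 = k by lia.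
have gE : crit_pt beta v = -1.
  by apply: crit_pt_unique; rewrite !vE ?kmE ?kE ?opprK ?subrK //; lia.
split.
- apply: crd_ext => i lti; rewrite crd_GS // cE !zE ?(ltnW lti) // addrK.
  by rewrite [RHS]subrK.
- apply: crd_ext => i lti; rewrite crd_dGS // crdZ cE gE !zE ?vE ?(ltnW lti) //.
  by rewrite addrK (tangentS _ _ i.+1); field.
apply/eqP => v0; move: gE; rewrite /crit_pt v0 -(scale0r v) !crdZ !mul0r mulr0.
by rewrite subr0 mul0r => /eqP; rewrite eq_sym oppr_eq0 oner_eq0.
Qed.

(** * From (k, m) to the true preperiod and period *)

Local Notation w := crit_orbit.
Local Notation e := tangent.

Lemma crit_orbit_step (c : C) i j : w c i = w c j -> w c i.+1 = w c j.+1.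
Proof. by rewrite /= => ->. Qed.

Lemma tangent_shift c mu i j n : w c i = w c j -> e c mu i = e c mu j ->
  e c mu (i + n) = e c mu (j + n).
Proof.
move=> wij eij; elim: n => [|n IH]; first by rewrite !addn0.
by rewrite !addnS !tangentS IH (orbit_shift (@crit_orbit_step c) n wij).
Qed.

Lemma tangent_periodic c mu i m q : w c (i + m) = w c i ->
  e c mu (i + m) = e c mu i -> e c mu (i + q * m) = e c mu i.
Proof.
move=> wi ei; elim: q => [|q IH]; first by rewrite addn0.
by rewrite mulSn addnA -[RHS]IH; apply: tangent_shift.
Qed.

(** One step after index k the factor beta disappears: w enters through w^d, and
    e through w^(d-1) e, which the two relations multiply by beta^d = 1. *)
Lemma resonant_return k m c mu : resonant k m c mu ->
  w c (k + m).+1 = w c k.+1 /\ e c mu (k + m).+1 = e c mu k.+1.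
Proof.
move=> [rw rt]; split=> /=; first by rewrite -[in RHS]rw exprMn hbeta mul1r.
rewrite -[in RHS]rw -[in RHS]rt; congr (_ / _ + _).
have -> : d = d.-1.+1 by rewrite prednK.
move: hbeta; rewrite -{1}(prednK d_gt0) exprS exprMn /= => hb.
by rewrite -[LHS]mul1r -hb; ring.
Qed.

Lemma tangent_after_zero c mu i : w c i = 0 -> e c mu i.+1 = 1.
Proof. by move=> wi; rewrite tangentS wi expr0n gtn_eqF // mulr0 !mul0r add0r. Qed.

(** When the orbit is periodic, e restarts each time w vanishes, so e takes the
    same value E at all positive multiples of m'. The closing relation for (k, m)
    then reads beta E = E, or beta E = 0 if k = 0; either way E = 0. *)
Lemma resonant_periodic k m c mu k' m' :
  (0 < m)%N -> resonant k m c mu ->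
  first_return (fun j => w c j.+1) k' m' -> w c (k + m) = 0 ->
  k' = 0%N /\ resonant 0 m' c mu.
Proof.
move=> m0 [rw rt] fr wkm.
have [m'0 uk' minkm] := fr.
have step i j : w c i.+1 = w c j.+1 -> w c i.+2 = w c j.+2.
  exact: crit_orbit_step.
have wk : w c k = 0 by rewrite -rw wkm mulr0.
have zero_ret i : (0 < i)%N -> w c i = 0 -> (k' <= 0)%N /\ (m' %| i)%N.
  move=> i0 wi; apply: (first_return_dvdn step fr i0 (a := 0%N)).
  by apply: (@crit_orbit_step c i 0).
have [k'0 dvkm] := zero_ret _ (ltn_addl k m0) wkm.
move: k'0; rewrite leqn0 => /eqP k'0; subst k'; split=> //.
have wper i q : (0 < i)%N -> w c (i + q * m') = w c i.
  case: i => // i _; rewrite addSn.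
  exact: (orbit_periodic step q uk' (leq0n i)).
have wm' : w c m' = 0.
  have := wper (k + m)%N 1%N (ltn_addl k m0); rewrite mul1n wkm.
  by rewrite (orbit_shift (@crit_orbit_step c) (j := 0) m').
have e_mul i : (0 < i)%N -> (m' %| i)%N -> e c mu i = e c mu m'.
  move=> i0 /dvdnP[q qE]; have q0 : (0 < q)%N by move: i0; rewrite qE; case: q {qE}.
  have e1 : e c mu (1 + m') = e c mu 1.
    by rewrite add1n !tangent_after_zero.
  have w1 : w c (1 + m') = w c 1 by rewrite add1n.
  have := tangent_shift (m' - 1) (wper 1%N q.-1 isT) (tangent_periodic q.-1 w1 e1).
  rewrite subnKC // => <-; congr (e c mu _).
  by rewrite qE; case: q q0 {qE} => // q _; lia.
have em' : e c mu m' = 0.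
  have [k0|k0] := posnP k.
    move: rt dvkm; rewrite k0 add0n => rt dvm.
    by apply: (mulfI beta_neq0); rewrite -(e_mul m) // rt mulr0.
  have [_ dvk] := zero_ret _ k0 wk.
  move: rt; rewrite !e_mul //; last by rewrite ltn_addl.
  move=> rt; apply: (mulfI beta1n0); rewrite mulr0 mulrBl rt mul1r subrr //.
by rewrite /resonant add0n wm' em' !mulr0.
Qed.

(** When the orbit is strictly preperiodic, w_k and w_{k+m} are distinct preimages
    of the same point, which forces k' = k. The alternative is whether e has the
    period m' of w; L is the multiplier of the cycle. *)
Lemma resonant_strict k m c mu k' m' :
  (0 < m)%N -> mu != 0 -> resonant k m c mu ->
  first_return (fun j => w c j.+1) k' m' -> w c (k + m) != 0 ->
  let L := \prod_(i < m') (d%:R * w c (k' + i).+1 ^+ d.-1) in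
  [/\ (0 < k)%N, k' = k & resonant k m' c mu \/
   mu ^+ m = L ^+ (m %/ m') /\ mu ^+ m' <> L].
Proof.
move=> m0 mun0 res fr wkm L.
have [rw rt] := res; have [wret eret] := resonant_return res.
have [m'0 uk' minkm] := fr.
have step i j : w c i.+1 = w c j.+1 -> w c i.+2 = w c j.+2.
  exact: crit_orbit_step.
have k0 : (0 < k)%N.
  rewrite lt0n; apply: contraNneq wkm => k0; apply/eqP/(mulfI beta_neq0).
  by rewrite rw k0 mulr0.
have [lek dvm] := first_return_dvdn step fr m0 wret.
have [q qE] := dvdnP dvm.
have q0 : (0 < q)%N by move: m0; rewrite qE; case: (q).
have wper i p : (k' < i)%N -> w c (i + p * m') = w c i.
  by case: i => // i lei; rewrite addSn; exact: (orbit_periodic step p uk' lei).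
have k'k : k' = k.
  apply/eqP; rewrite eqn_leq lek leqNgt; apply/negP => ltk.
  have wkk : w c (k + m) = w c k by rewrite qE wper.
  case/negP: wkm; have := rw; rewrite -wkk => /eqP.
  by rewrite -subr_eq0 -[X in _ - X]mul1r -mulrBl mulf_eq0 (negbTE beta1n0).
subst k'; split=> //.
have kmE : (k + m = k + m' + q.-1 * m')%N.
  by rewrite qE; case: (q) q0 => // p _; lia.
have wkm' : w c (k + m) = w c (k + m').
  by rewrite kmE wper //; lia.
have wk1 : w c (k.+1 + m') = w c k.+1 by rewrite -[m']mul1n wper.
have [e_eq|e_neq] := eqVneq (e c mu (k.+1 + m')) (e c mu k.+1).
  left; split; first by rewrite -wkm'.
  rewrite -rt; congr (_ * _); rewrite kmE.
  have -> : (k + m' = k.+1 + (m' - 1))%N by lia.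
  rewrite -addnA [(_ - _ + _)%N]addnC addnA; symmetry.
  apply: tangent_shift; first by rewrite wper.
  exact: tangent_periodic.
(* The defect h of m'-periodicity of e solves the homogeneous recursion. *)
right; pose p i := d%:R * w c (k.+1 + i) ^+ d.-1.
have pper i : p (i + m')%N = p i.
  by rewrite /p addnA -[m']mul1n wper //; lia.
pose h i := e c mu (k.+1 + i + m') - e c mu (k.+1 + i).
have hS i : h i.+1 = p i / mu * h i.
  rewrite /h addnS addSn !tangentS.
  rewrite [w c (k.+1 + i + m')](_ : _ = w c (k.+1 + i)); last first.
    by rewrite -[m']mul1n wper //; lia.
  by rewrite /p; field.
have hE i : h i = (\prod_(j < i) p j) / mu ^+ i * h 0%N.
  elim: i => [|i IH]; first by rewrite big_ord0 divr1 mul1r.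
  rewrite hS IH big_ord_recr exprS /=; field.
  by rewrite mun0 expf_neq0.
have LE : \prod_(j < m') p j = L by [].
have hqE r : h (r * m')%N = L ^+ r / mu ^+ (r * m') * h 0%N.
  by rewrite hE prod_periodic // LE.
have h0 : h 0%N != 0 by rewrite /h addn0 subr_eq0.
have em : e c mu (k.+1 + q * m') = e c mu k.+1 by rewrite -qE addSn.
have wm : w c (k.+1 + q * m') = w c k.+1 by rewrite wper.
split.
  have hm : h (q * m')%N = h 0%N.
    rewrite /h addn0; congr (_ - _); last exact: em.
    exact: tangent_shift.
  move: hm; rewrite hqE -qE => /(canRL (mulfK h0)); rewrite mulfV // => E.
  rewrite qE mulnK // -qE; have mum : mu ^+ m != 0 by rewrite expf_neq0.
  by rewrite -[RHS](divfK mum) E mul1r.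
move=> muL.
(* With trivial monodromy h is m'-periodic, so e grows linearly along multiples
   of m'; this contradicts its m-periodicity. *)
have tel r : e c mu (k.+1 + r * m') = e c mu k.+1 + r%:R * h 0%N.
  elim: r => [|r IH]; first by rewrite addn0 mul0r addr0.
  have := hqE r; rewrite mulnC exprM muL divff ?mul1r; last first.
    by rewrite expf_neq0 // -muL expf_neq0.
  rewrite {1}/h mulnC => /(canRL (subrK _)).
  rewrite mulSn addnA addnAC => ->.
  by rewrite IH mulrS; ring.
have /eqP := tel q; rewrite em -subr_eq0 opprD addrA subrr add0r oppr_eq0.
by rewrite mulf_eq0 (negbTE h0) pnatr_eq0 orbF gtn_eqF.
Qed.

(** * Post-critical points *)

(** A coincidence among 0 = x_0, x_1, ..., x_n. *)
Definition collision n (x : 'rV[C]_n) :=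
  exists a b, [/\ (a < b)%N, (b <= n)%N & crd x a = crd x b].

Lemma crd0 n (x : 'rV[C]_n) : crd x 0 = 0. Proof. by []. Qed.

(** G sends x_i to the coordinate of index i + 1 by one and the same map, so equal
    coordinates have equal images. The last coordinate has no successor, but its
    image under that map is the coordinate of index 0 (k = 0) or k (k > 0). *)
Lemma G_collision k m (x : 'rV[C]_(k + m - 1)) : (0 < m)%N ->
  collision x -> collision (G d beta x).
Proof.
move=> m0 [a [b [ltab leb xab]]].
have [k0|k0] := posnP k.
  subst k; have [eqb|ltb] := eqVneq b (m - 1)%N.
    exists 0%N, a.+1; split=> //; first exact: leq_trans leb.
    by rewrite crd0 crd_G0 ?(leq_trans ltab leb) // xab eqb subrr.
  have lt_b : (b < 0 + m - 1)%N by rewrite ltn_neqAle ltb.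
  exists a.+1, b.+1; split=> //.
  by rewrite !crd_G0 ?xab // (ltn_trans ltab).
have lt_a : (a < k + m - 1)%N by apply: leq_trans leb.
have kE : (k - 1).+1 = k by lia.
have [eqb|ltb] := eqVneq b (k + m - 1)%N; last first.
  have lt_b : (b < k + m - 1)%N by rewrite ltn_neqAle ltb.
  by exists a.+1, b.+1; split=> //; rewrite !(crd_GS _ k0) ?xab.
have Gk : crd (G d beta x) k = crd (G d beta x) a.+1.
  have := crd_GS x k0 (_ : (k - 1 < k + m - 1)%N); rewrite kE => -> //; last lia.
  rewrite (crd_GS _ k0) //.
  by rewrite -crit_ptP // exprMn hbeta mul1r xab eqb.
(* If both indices are k, the point fixed by the rotation is c itself, so the
   coordinate of index k collides with x_0 instead. *)
have [eqa|neqa] := eqVneq a.+1 k.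
  exists 0%N, k; split=> //; first lia.
  have xn : crd x (k + m - 1) = crd x a by rewrite xab eqb.
  have := crit_ptP x; rewrite xn.
  rewrite (_ : (k - 1)%N = a); last lia.
  move=> /eqP; rewrite -subr_eq0 -[X in _ - X]mul1r -mulrBl mulf_eq0 subr_eq0.
  rewrite (negbTE hbeta1) /= => /eqP xc.
  by rewrite Gk (crd_GS _ k0) // xc expr0n gtn_eqF.
have [lt_ak|lt_ka|eq_ak] := ltngtP a.+1 k; last by rewrite eq_ak eqxx in neqa.
  by exists a.+1, k; split=> //; lia.
by exists k, a.+1; split=> //; lia.
Qed.

(** A kernel vector of the differential vanishes unless some factor x_i
    (k = 0, i > 0) or x_i - c (k > 0, i < n) is zero. For k = 0 this is already a
    collision of x_i with x_0; for k > 0 it makes the next coordinate of the image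
    equal to 0. *)
Lemma critical_collision k m (x : 'rV[C]_(k + m - 1)) : (0 < m)%N ->
  critical_set (@G C d beta k m) x -> collision (G d beta x).
Proof.
move=> m0; rewrite /critical_set /= -eigenvalue0 => /eigenvalue_G[v].
rewrite scale0r => dGv vn0.
have dGi i : crd (dG d beta x v) i.+1 = 0 by rewrite dGv -(scale0r v) crdZ mul0r.
have powM (s t : C) : s != 0 -> d%:R * s ^+ d.-1 * t = 0 -> t = 0.
  move=> s0 /eqP; rewrite !mulf_eq0 (negbTE dn0) expf_eq0 (negbTE s0) andbF.
  by move=> /eqP.
have [k0|k0] := posnP k.
  subst k; apply: G_collision => //; apply: contrapT => ncol.
  have xn0 i : (0 < i)%N -> (i <= 0 + m - 1)%N -> crd x i != 0.
    move=> i0 lei; apply/eqP => xi; apply: ncol.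
    by exists 0%N, i; split.
  case/negP: vn0; apply/eqP/crd_eq0 => i lti.
  have n0 : (0 < m - 1)%N by apply: leq_trans lti.
  have A0 : d%:R * crd x (m - 1) ^+ d.-1 * crd v (m - 1) = 0.
    have := dGi 0%N; rewrite crd_dG0 // !crd0 mulr0 sub0r => /eqP.
    by rewrite oppr_eq0 => /eqP.
  have [eqi|neqi] := eqVneq i.+1 (m - 1)%N.
    by rewrite eqi; apply: powM A0; apply: xn0.
  have lti1 : (i.+1 < m - 1)%N by rewrite ltn_neqAle neqi.
  have := dGi i.+1; rewrite crd_dG0 // A0 subr0.
  by apply: powM; apply: xn0.
have n0 : (0 < k + m - 1)%N by lia.
have [[i lti xi]|ncrit] := pselect (exists2 i, (i < k + m - 1)%N &
    crd x i = crit_pt beta x).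
  exists 0%N, i.+1; split=> //.
  by rewrite crd0 (crd_GS _ k0) // xi subrr expr0n gtn_eqF.
have vE i : (i < k + m - 1)%N -> crd v i = crit_pt beta v.
  move=> lti; apply/eqP; rewrite -subr_eq0; apply/eqP.
  have := dGi i; rewrite (crd_dGS _ _ k0) //; apply: powM.
  by rewrite subr_eq0; apply/eqP => xi; apply: ncrit; exists i.
have g0 : crit_pt beta v = 0 by rewrite -(vE 0%N n0).
case/negP: vn0; apply/eqP/crd_eq0 => i lti.
have [eqi|neqi] := eqVneq i.+1 (k + m - 1)%N; last first.
  by rewrite vE ?g0 // ltn_neqAle neqi.
apply: (mulfI beta_neq0); have := crit_ptP v.
by rewrite eqi g0 !subr0 => ->; rewrite vE ?g0 ?mulr0 //; lia.
Qed.

Lemma post_critical_collision k m (x : 'rV[C]_(k + m - 1)) : (0 < m)%N ->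
  post_critical_set (@G C d beta k m) x -> collision x.
Proof.
move=> m0 [[//|j] _ [y yC <-]].
elim: j => [|j IH]; first exact: critical_collision.
exact: G_collision.
Qed.

Lemma eigenvalue0_post_critical k m (z : 'rV[C]_(k + m - 1)) :
  eigenvalue_at (@G C d beta k m) z 0 ->
  post_critical_set (@G C d beta k m) z.
Proof.
move=> [Gz]; rewrite eigenvalue0 => zC.
by exists 1%N => //; exists z.
Qed.

Lemma row_of_no_collision n (f : nat -> C) : f 0%N = 0 ->
  (forall a b, (a < b)%N -> (b <= n)%N -> f a <> f b) ->
  ~ collision (row_of n f).
Proof.
move=> f0 finj [a [b [ltab leb]]].
by rewrite !crd_row_of ?(leq_trans (ltnW ltab)) //; apply: finj.
Qed.

(** * The dynamics of the associated polynomial *)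

Lemma poly_iter_marked_orbit k m (z : 'rV[C]_(k + m - 1)) c mu i :
  (0 < m)%N -> resonant k m c mu ->
  (forall i, (i <= k + m - 1)%N -> crd z i = marked_orbit k c i) ->
  (poly_iter (assoc_poly d beta z) i).[0] = marked_orbit k c i.
Proof.
move=> m0 [rw _] zE; rewrite poly_iterE.
elim: i => [|i /= ->]; first by rewrite marked_orbit0.
rewrite /assoc_poly; have [k0|k0] := posnP k.
  subst k; rewrite /marked_orbit /= in zE rw *.
  by rewrite zE // (resonant_crit_value m0 rw) !hornerE.
rewrite (resonant_crit_pt k0 m0 rw zE) /marked_orbit (gtn_eqF k0).
by rewrite !hornerE addrK [RHS]subrK.
Qed.

Lemma deriv_assoc_poly k m (z : 'rV[C]_(k + m - 1)) c mu i :
  (0 < k)%N -> (0 < m)%N -> resonant k m c mu ->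
  (forall i, (i <= k + m - 1)%N -> crd z i = marked_orbit k c i) ->
  (assoc_poly d beta z)^`().[marked_orbit k c i] =
  d%:R * crit_orbit c i.+1 ^+ d.-1.
Proof.
move=> k0 m0 [rw _] zE; rewrite /assoc_poly /marked_orbit gtn_eqF //.
rewrite (resonant_crit_pt k0 m0 rw zE) deriv_exp derivXsubC mul1r.
by rewrite hornerMn !hornerE addrK mulr_natl.
Qed.

(** Shifting by one index makes the cases k = 0 and k > 0 uniform. For k = 0 this
    changes neither the preperiod nor the period, because the orbit of 0 is
    periodic. *)
Lemma first_return_crit_orbit k m c k' m' : (0 < m)%N ->
  beta * crit_orbit c (k + m) = crit_orbit c k ->
  first_return (marked_orbit k c) k' m' ->
  first_return (fun j => crit_orbit c j.+1) k' m'.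
Proof.
move=> m0 rw; rewrite /marked_orbit; have [k0|k0] := posnP k; last first.
  case=> m'0 uk minkm; split=> //; first exact: addIr uk.
  by move=> a b b0 E; apply: minkm => //; rewrite E.
subst k; case=> m'0 uk minkm.
have wm : crit_orbit c (0 + m) = 0.
  by apply: (mulfI beta_neq0); rewrite rw mulr0.
have [k'0 _] := minkm _ _ m0 wm.
move: k'0; rewrite leqn0 => /eqP k'0; subst k'.
split=> //; first exact: crit_orbit_step uk.
by move=> a b b0 E; have [_] := minkm a.+1 b b0 E.
Qed.

Lemma marked_orbit_inj k c k' m' :
  first_return (fun j => crit_orbit c j.+1) k' m' ->
  forall a b, (a < b)%N -> (b <= k' + m' - 1)%N ->
  marked_orbit k c a <> marked_orbit k c b.
Proof.
move=> fr a b ltab leb wab.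
apply: (first_return_uniq (fun i j => @crit_orbit_step c i.+1 j.+1) fr ltab leb).
move: wab; rewrite /marked_orbit; case: ifP => _ => [|/addIr //].
exact: crit_orbit_step.
Qed.

Lemma resonant_eigenvalue_off_post_critical c mu k' m' : mu != 0 ->
  first_return (fun j => crit_orbit c j.+1) k' m' ->
  resonant k' m' c mu ->
  exists z' : 'rV[C]_(k' + m' - 1),
    eigenvalue_at (@G C d beta k' m') z' mu /\
    ~ post_critical_set (@G C d beta k' m') z'.
Proof.
move=> mun0 fr res; have [m'0 _ _] := fr.
exists (row_of _ (marked_orbit k' c)); split.
  exact: resonant_eigenvalue.
move=> /(post_critical_collision m'0).
apply: row_of_no_collision; first exact: marked_orbit0.
exact: marked_orbit_inj fr.
Qed.

(** The dichotomy for nonzero eigenvalues: everything is read off the closing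
    relations, according to whether the orbit is periodic (0 returns to itself)
    or strictly preperiodic. *)
Lemma nonzero_eigenvalue_cases k m (z : 'rV[C]_(k + m - 1)) mu k' m' :
  (0 < m)%N -> mu != 0 -> eigenvalue_at (@G C d beta k m) z mu ->
  preperiodic (assoc_poly d beta z) (crd z 0) k' m' ->
  let lambda := multiplier (assoc_poly d beta z) (crd z 0) k' m' in
  (exists z' : 'rV[C]_(k' + m' - 1),
    eigenvalue_at (@G C d beta k' m') z' mu /\
    ~ post_critical_set (@G C d beta k' m') z') \/
  (mu ^+ m = lambda ^+ (m %/ m') /\ mu ^+ m' <> lambda).
Proof.
move=> hm mun0 hmu hpre lambda.
have m'0 : (0 < m')%N by case: hpre => [[]].
have [c res zE] := eigenvalue_resonant hm mun0 hmu.
have PE := poly_iter_marked_orbit _ hm res zE.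
have fr0 : first_return (marked_orbit k c) k' m'.
  move: hpre; rewrite crd0 => -[[_ E] minkm]; split=> //.
    by rewrite -!PE.
  by move=> a b b0; rewrite -!PE => ab; apply: minkm; split.
have fr := first_return_crit_orbit hm res.1 fr0.
have [wkm|wkm] := eqVneq (crit_orbit c (k + m)) 0.
  have [k'0 res'] := resonant_periodic hm res fr wkm.
  by left; subst k'; apply: (resonant_eigenvalue_off_post_critical mun0 fr).
have [k0 k'k] := resonant_strict hm mun0 res fr wkm.
subst k'; case=> [res'|lamP].
  by left; apply: (resonant_eigenvalue_off_post_critical mun0 fr).
right; rewrite /lambda multiplierE.
under eq_bigr do rewrite crd0 PE (deriv_assoc_poly _ k0 hm res zE).
exact: lamP.
Qed.

End Spectrum.

Theorem theorem1 (R : realType) (d : nat) (beta : R[i])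
    (hd : (2 <= d)%N) (hbeta : beta ^+ d = 1) (hbeta1 : beta != 1)
    (k m : nat) (hm : (1 <= m)%N)
    (z : 'rV[R[i]]_(k + m - 1)) (mu : R[i])
    (hmu : eigenvalue_at (@G R[i] d beta k m) z mu)
    (k' m' : nat) (lambda : R[i])
    (hpre : preperiodic (assoc_poly d beta z) (crd z 0) k' m')
    (hlambda : lambda = multiplier (assoc_poly d beta z) (crd z 0) k' m') :
  let case1 := mu = 0 in
  let case2 := exists z' : 'rV[R[i]]_(k' + m' - 1),
    eigenvalue_at (@G R[i] d beta k' m') z' mu /\
    ~ post_critical_set (@G R[i] d beta k' m') z' in
  let case3 := mu ^+ m = lambda ^+ (m %/ m') /\ mu ^+ m' <> lambda in
  [/\ [\/ case1, case2 | case3], ~ (case1 /\ case2) & ~ (case1 /\ case3)].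
Proof.
move=> case1 case2 case3.
have m'0 : (0 < m')%N by case: hpre => [[]].
split; last 2 first.
- case=> mu0 [z' [z'mu]]; apply; apply: eigenvalue0_post_critical.
  by rewrite mu0 in z'mu.
- case=> mu0 [mum []]; move: mum; rewrite mu0 !expr0n !gtn_eqF //.
  by move=> /esym/eqP; rewrite expf_eq0 => /andP[_ /eqP].
have [mu0|mun0] := eqVneq mu 0; first by apply: Or31.
have := nonzero_eigenvalue_cases hd hbeta hbeta1 hm mun0 hmu hpre.
by rewrite -hlambda => -[?|?]; [apply: Or32|apply: Or33].
Qed.
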